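(* Let $t\ge2$, $r\ge1$, $N=t+2r$, $\zeta=e^{2\pi i/t}$, and let $\lambda$ be a partition with at most $N$ parts such that $n_i\ge1$ for every residue $i$ modulo $t$. Put $C=\min\mathcal{S}+\max\mathcal{S}$. Suppose that $$C-\mathcal{S}=\mathcal{S}\qquad\text{and}\qquad \Delta_i(k)=C\ \text{ for some } i\in\mathcal{E} \text{ and some } k \text{ with } 1\le k\le n_i-1.$$ Then $s_\lambda\bigl(1,\zeta,\dots,\zeta^{t-1},z_1,z_1^{-1},\dots,z_r,z_r^{-1}\bigr)\equiv0$ identically in $z_1,\dots,z_r$.
   Context: For $\lambda=(\lambda_1\ge\dots\ge\lambda_N\ge0)$ let $\beta_j=\lambda_j+N-j$ ($1\le j\le N$) and let $n_i$ be the number of $\beta_j\equiv i\pmod t$. Let $\mathcal{E}=\{i\in\mathbb{Z}/t:n_i\ge2\}$ and $\mathcal{S}=\{\beta_j:\beta_j\bmod t\in\mathcal{E}\}$ (the excess part of the beta set; nonempty since $N>t$). For $i\in\mathcal{E}$ list the values of $\mathcal{S}$ in class $i$ as $c_{i,1}>\dots>c_{i,n_i}$ and let $\Delta_i(k)=c_{i,k}+c_{i,k+1}$ for $1\le k\le n_i-1$. $C-\mathcal{S}=\{C-x:x\in\mathcal{S}\}$. $s_\lambda$ is the Schur polynomial in $N$ variables. *)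

(* Defs.v *)
From HB Require Import structures.
From mathcomp Require Import all_boot all_order all_fingroup all_algebra.
From mathcomp Require Import reals trigo complex.
From mathcomp Require Import mpoly.

Set Implicit Arguments.
Unset Strict Implicit.
Unset Printing Implicit Defensive.

Import GRing.Theory.

Local Open Scope ring_scope.

(* A partition with at most N parts is an N-tuple of naturals, padded with    *)
(* zeros, that is weakly decreasing.                                          *)
Definition is_partition (N : nat) (lam : N.-tuple nat) : bool :=
  sorted geq lam.

(* Indices are shifted by one: the (j+1)-st part contributes                  *)
(* lambda_(j+1) + N - (j+1).                                                  *)
Definition beta (N : nat) (lam : N.-tuple nat) (j : 'I_N) : nat :=
  (tnth lam j + (N - j.+1))%N.

(** * Schur polynomials: s_lambda = a_(lambda + delta) / a_delta *)

Definition alternant (N : nat) (R : comNzRingType) (a : 'I_N -> nat) :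
    {mpoly R[N]} :=
  \det (\matrix_(i < N, j < N) ('X_i : {mpoly R[N]}) ^+ a j).

Definition delta (N : nat) (j : 'I_N) : nat := (N - j.+1)%N.

(* Reducing each 'X^(a j) modulo \prod_i ('X - x_i) gives a factorization of  *)
(* the matrix (x_i ^ a_j) through the matrix (x_i ^ k).                       *)
Lemma alternant_dvd (N : nat) (R : comNzRingType) (a : 'I_N -> nat) :
  exists s : {mpoly R[N]}, s * alternant R (@delta N) == alternant R a.
Proof.
pose P : {poly {mpoly R[N]}} := \prod_(i < N) ('X - ('X_i)%:P).
have monP : P \is monic by apply: monic_prod_XsubC.
have sizeP : size P = N.+1.
  by rewrite size_prod_XsubC -[index_enum _]enumT size_enum_ord.
pose c j := Pdiv.Ring.rmodp 'X^(a j) P.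
have size_c j : (size (c j) <= N)%N.
  by rewrite -ltnS -sizeP Pdiv.Ring.ltn_rmodpN0 // monic_neq0.
exists (\det (\matrix_(k < N, j < N) (c j)`_(delta k))).
rewrite mulrC /alternant -det_mulmx; apply/eqP; congr (\det _).
apply/matrixP=> i j; rewrite !mxE.
have rootP : P.['X_i] = 0.
  by rewrite /P (bigD1 i) //= hornerM hornerXsubC subrr mul0r.
have := congr1 (horner^~ ('X_i : {mpoly R[N]}))
  (Pdiv.RingMonic.rdivp_eq monP 'X^(a j)).
rewrite /= hornerXn hornerD hornerM rootP mulr0 add0r -/(c j) => ->.
rewrite (horner_coef_wide _ (size_c j)) (reindex_inj rev_ord_inj) /=.
apply: eq_bigr => k _; rewrite !mxE mulrC.
by rewrite /delta /= subnSK ?ltn_ord // subKn // ltnW.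
Qed.

Definition schur (N : nat) (R : comNzRingType) (lam : N.-tuple nat) :
    {mpoly R[N]} :=
  xchoose (alternant_dvd R (beta lam)).

Lemma schurE (N : nat) (R : comNzRingType) (lam : N.-tuple nat) :
  schur R lam * alternant R (@delta N) = alternant R (beta lam).
Proof. exact/eqP/(xchooseP (alternant_dvd R (beta lam))). Qed.

Lemma alternant_delta_neq0 (N : nat) (R : idomainType) :
  alternant R (@delta N) != 0.
Proof.
pose v : 'rV[{mpoly R[N]}]_N := \row_i 'X_(rev_ord i).
suff -> : alternant R (@delta N) = \det (Vandermonde N v).
  rewrite det_Vandermonde; apply/prodf_neq0 => i _; apply/prodf_neq0 => j ltij.
  rewrite !mxE subr_eq0; apply/negP => /eqP /(congr1 (mcoeff U_(rev_ord j)))/eqP.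
  rewrite !mcoeffXU eqxx (inj_eq rev_ord_inj).
  by rewrite -val_eqE ltn_eqF //= oner_eq0.
pose M : 'M[{mpoly R[N]}]_N := \matrix_(i, j) 'X_i ^+ delta j.
have -> : Vandermonde N v = (row_perm (perm rev_ord_inj)
                              (col_perm (perm rev_ord_inj) M))^T.
  apply/matrixP=> i j; rewrite !mxE !permE /delta /=; congr (_ ^+ _).
  by rewrite subnSK ?ltn_ord // subKn // ltnW.
rewrite det_tr row_permE col_permE !det_mulmx !det_perm odd_permV.
by rewrite mulrC -mulrA -signr_addb addbb mulr1.
Qed.

Lemma schur_unique (N : nat) (R : idomainType) (lam : N.-tuple nat)
    (s : {mpoly R[N]}) :
  s * alternant R (@delta N) = alternant R (beta lam) -> s = schur R lam.
Proof.
by rewrite -schurE => /mulIf; apply; exact: alternant_delta_neq0.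
Qed.

(** * The excess part of the beta set *)

Definition nres (t N : nat) (lam : N.-tuple nat) (i : 'I_t) : nat :=
  #|[set j : 'I_N | beta lam j %% t == i]%N|.

Definition excess_classes (t N : nat) (lam : N.-tuple nat) : {set 'I_t} :=
  [set i : 'I_t | (2 <= nres lam i)%N].

(* S, as a list; its elements are distinct when lam is a partition.           *)
Definition excess (t N : nat) (lam : N.-tuple nat) : seq nat :=
  [seq beta lam j | j <- enum 'I_N
     & [exists i in excess_classes t lam, beta lam j %% t == i]%N].

Definition excess_class (t N : nat) (lam : N.-tuple nat) (i : 'I_t) : seq nat :=
  sort geq [seq x <- excess t lam | x %% t == i]%N.

(* excess_class starts at index 0, so c_(i,k) is its item k - 1; only         *)
(* 1 <= k <= n_i - 1 is meaningful.                                           *)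
Definition Delta (t N : nat) (lam : N.-tuple nat) (i : 'I_t) (k : nat) : nat :=
  (nth 0 (excess_class lam i) k.-1 + nth 0 (excess_class lam i) k)%N.

Definition seq_max (s : seq nat) : nat := (\max_(x <- s) x)%N.

(* The minimum of s if s is nonempty, and 0 otherwise.                        *)
Definition seq_min (s : seq nat) : nat := \big[minn/seq_max s]_(x <- s) x.

Definition excess_sum (t N : nat) (lam : N.-tuple nat) : nat :=
  (seq_min (excess t lam) + seq_max (excess t lam))%N.

(** * The specialization point *)

Definition zeta (R : realType) (t : nat) : R[i] :=
  (cos (2 * pi / t%:R) +i* sin (2 * pi / t%:R))%C.

Definition spec_seq (R : realType) (t r : nat) (z : 'I_r -> R[i]) : seq R[i] :=
  [seq zeta R t ^+ k | k <- iota 0 t]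
  ++ flatten [seq [:: z i; (z i)^-1] | i <- enum 'I_r].

(* spec_seq has exactly t + 2 * r items, so no default value is ever read.    *)
Definition spec_point (R : realType) (t r : nat) (z : 'I_r -> R[i]) :
    'I_(t + 2 * r) -> R[i] :=
  fun j => nth 0 (spec_seq t z) j.
Arguments spec_point {R} t {r} z.

(* Main.v *)
(* Let M be the matrix (x_a ^ beta_j) at the specialization point, S the excess
   part of the beta set and E its set of residue classes.  The rows of M at the
   roots of unity are combinations of the indicator rows of the residue classes,
   and on a column outside S the rows at z_i^(+-1) can be cleared by such an
   indicator row; so M = B A where A consists of indicator rows and of the rows
   z_i^(+-beta) restricted to S.  Reflecting the columns of S by x |-> C - x
   amounts, up to row factors of product 1, to reflecting the indicator rows of E
   by i |-> C - i and exchanging the rows at z_i and z_i^-1.  The hypothesis on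
   Delta forces these two permutations to have opposite signs, so det A = 0.
   Hence s_lambda vanishes wherever the coordinates of the point are distinct,
   and the remaining points are reached along the curve z_i + u^(i+1). *)

Require Import Defs.
From mathcomp Require Import all_boot all_order all_fingroup all_algebra.
From mathcomp Require Import reals trigo complex.
From mathcomp Require Import mpoly.
From mathcomp Require Import zify lra.

Set Implicit Arguments.
Unset Strict Implicit.
Unset Printing Implicit Defensive.

Import Order.TTheory GRing.Theory Num.Theory.

Local Open Scope ring_scope.

(** * Determinants with a symmetry *)

(** An involution is a product of disjoint transpositions, one for each pair of moved points; the
    induction strips them off one at a time. *)
Lemma odd_perm_involutive (T : finType) (s : {perm T}) :
  involutive s ->
  (odd_perm s = odd (#|[set x | s x != x]|)./2)
  /\ ~~ odd #|[set x | s x != x]|.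
Proof.
have [n] := ubnP #|[set x | s x != x]|; elim: n s => // n IHn s ltsn sK.
have [s1 | [x sx]] := set_0Vmem [set x | s x != x].
  rewrite s1 cards0; split=> //; suff -> : s = 1%g by rewrite odd_perm1.
  apply/permP=> x; rewrite perm1; apply/eqP/negPn.
  by apply/negP=> sx; have := in_set0 x; rewrite -s1 inE sx.
move: sx; rewrite inE => sx.
(* [u] agrees with [s] except that it fixes [x] and [s x], so it moves two points fewer. *)
pose u := (tperm x (s x) * s)%g.
have uE y : u y = if (y == x) || (y == s x) then y else s y.
  rewrite permM; case: tpermP => [->|->|/eqP/negPf-> /eqP/negPf->] //.
    by rewrite eqxx sK.
  by rewrite eqxx orbT.
have uK : involutive u.
  move=> y; have [fixy|] := boolP ((y == x) || (y == s x)).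
    by rewrite !(uE y) fixy uE fixy.
  move=> /[dup] /negPf movey /norP[nyx nysx]; rewrite (uE y) movey uE.
  by rewrite (can2_eq sK sK) (negPf nysx) (inj_eq perm_inj) (negPf nyx) /= sK.
have sE : [set y | s y != y] = x |: (s x |: [set y | u y != y]).
  apply/setP=> y; rewrite !inE uE.
  by have [->|_] /= := eqVneq y x; last have [->|_] /= := eqVneq y (s x);
     rewrite ?sK // eq_sym.
have card_s : #|[set y | s y != y]| = #|[set y | u y != y]|.+2.
  rewrite sE !cardsU1 !inE !uE !eqxx orbT !eqxx (eq_sym x) (negPf sx) /=.
  by rewrite add1n.
have ltun : (#|[set y | u y != y]| < n)%N by lia.
have [oddu evenu] := IHn u ltun uK.
rewrite card_s /= negbK; split=> //; move: oddu.
by rewrite odd_mul_tperm eq_sym sx => <- /=; rewrite negbK.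
Qed.

(** Taking determinants on both sides of the symmetry gives [\det A = - \det A], and 2 is nonzero in
    a numeric domain. *)
Lemma det_eq0_of_symmetry (F : numDomainType) n (A : 'M[F]_n)
    (sigma rho : 'S_n) (d : 'I_n -> F) :
  (forall i j, A i (sigma j) = d i * A (rho i) j) -> \prod_i d i = 1 ->
  odd_perm sigma != odd_perm rho -> \det A = 0.
Proof.
move=> Asym d1 sgn.
have : col_perm sigma A = diag_mx (\row_i d i) *m row_perm rho A.
  by apply/matrixP=> i j; rewrite mul_diag_mx !mxE Asym.
move/(congr1 determinant).
rewrite col_permE row_permE !det_mulmx !det_perm det_diag odd_permV.
rewrite (eq_bigr d) => [|i _]; last by rewrite mxE.
rewrite d1 mul1r; move: sgn.
have two0 : 2 != 0 :> F by rewrite pnatr_eq0.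
case: (odd_perm sigma); case: (odd_perm rho) => // _.
- rewrite expr1 expr0 mulrN1 mul1r => /esym/eqP.
  by rewrite -addr_eq0 -mulr2n -mulr_natr mulf_eq0 (negPf two0) orbF => /eqP.
- rewrite expr1 expr0 mulN1r mulr1 => /eqP.
  by rewrite -addr_eq0 -mulr2n -mulr_natr mulf_eq0 (negPf two0) orbF => /eqP.
Qed.

Lemma det_vandermonde_neq0 (F : fieldType) n (x : 'I_n -> F) :
  injective x -> \det (\matrix_(i, j) x i ^+ delta j) != 0.
Proof.
move=> x_inj; pose V := Vandermonde n (\row_i x i).
have -> : \matrix_(i, j) x i ^+ delta j = col_perm (perm rev_ord_inj) V^T.
  by apply/matrixP=> i j; rewrite !mxE permE.
rewrite col_permE det_mulmx det_tr det_perm mulf_neq0 ?signr_eq0 //.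
rewrite det_Vandermonde; apply/prodf_neq0 => i _; apply/prodf_neq0 => j ltij.
by rewrite !mxE subr_eq0 (inj_eq x_inj) -val_eqE gtn_eqF.
Qed.

(** In characteristic 0 the naturals below [size p] are already too many distinct roots. *)
Lemma poly_eq0_of_horner (F : numDomainType) (p : {poly F}) :
  (forall u, p.[u] = 0) -> p = 0.
Proof.
move=> p0; apply: (@roots_geq_poly_eq0 _ _ [seq i%:R | i <- iota 0 (size p)]).
- by apply/allP=> u _; apply/rootP.
- by rewrite map_inj_uniq ?iota_uniq //; apply: mulrIn; rewrite oner_neq0.
- by rewrite size_map size_iota.
Qed.

(** * The reflection of the excess part *)

(** Column indices stand in for the values of S, since determinants need permutations of indices;
    [beta_inj] makes the passage faithful. *)
Definition excess_cols t N (lam : N.-tuple nat) : {set 'I_N} :=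
  [set j | [exists i in excess_classes t lam, beta lam j %% t == i]%N].

Lemma beta_inj N (lam : N.-tuple nat) : is_partition lam -> injective (beta lam).
Proof.
move=> hlam; suff lt_beta (j k : 'I_N) : (j < k)%N -> (beta lam k < beta lam j)%N.
  move=> j k ejk; apply/val_inj/eqP; rewrite eqn_leq leqNgt andbC leqNgt.
  by apply/andP; split; apply/negP=> /lt_beta; rewrite ejk ltnn.
move=> ltjk; rewrite /beta !(tnth_nth 0%N).
have geq_trans : transitive geq by move=> a b c ? /leq_trans; apply.
have := sorted_ltn_nth geq_trans 0%N hlam.
move=> /(_ j k); rewrite !inE !size_tuple !ltn_ord => /(_ isT isT ltjk) /= le_lam.
have := ltn_ord k; lia.
Qed.

Lemma mem_excess t N (lam : N.-tuple nat) x :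
  reflect (exists2 j, j \in excess_cols t lam & x = beta lam j)
          (x \in excess t lam).
Proof.
by apply: (iffP mapP) => -[j jS ->]; exists j => //; move: jS;
  rewrite mem_filter mem_enum andbT inE.
Qed.

Lemma uniq_excess t N (lam : N.-tuple nat) :
  is_partition lam -> uniq (excess t lam).
Proof.
move=> hlam; rewrite map_inj_uniq; last exact: beta_inj.
by rewrite filter_uniq ?enum_uniq.
Qed.

Lemma leq_excess_sum t N (lam : N.-tuple nat) x :
  x \in excess t lam -> (x <= excess_sum t lam)%N.
Proof.
move=> xS; apply: leq_trans (leq_addl _ _).
by rewrite /seq_max (big_rem x) //= leq_maxl.
Qed.

Lemma size_excess_class t N (lam : N.-tuple nat) (i : 'I_t) :
  i \in excess_classes t lam -> size (excess_class lam i) = nres lam i.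
Proof.
move=> iE; rewrite size_sort filter_map size_map -filter_predI.
rewrite /nres cardsE cardE [enum _ in RHS]/enum_mem enumT; congr size.
apply: eq_filter => j; rewrite /= unfold_in -[eqn _ _]/(_ == nat_of_ord i).
have [ji|//] := eqVneq; by apply/existsP; exists i; rewrite iE ji eqxx.
Qed.

(** The map i -> C - i on residues; [t - i] replaces the negative of [i] to avoid truncated
    subtraction. *)
Definition reflect_res t (C : nat) (i : 'I_t) : 'I_t :=
  Ordinal (ltn_pmod (C + (t - i)) (leq_ltn_trans (leq0n i) (ltn_ord i))).

Lemma reflect_resE t C (i : 'I_t) x :
  (x <= C)%N -> (x %% t = i)%N -> ((C - x) %% t = reflect_res C i)%N.
Proof.
move=> lexC xi /=; have /ltnW le_it := ltn_ord i.
apply/eqP; rewrite -(eqn_modDr x) subnK //.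
rewrite -modnDmr xi -addnA subnK //.
by rewrite modnDr.
Qed.

Lemma reflect_resK t C : involutive (@reflect_res t C).
Proof.
move=> i; apply/val_inj; rewrite /= -[RHS](modn_small (ltn_ord i)).
have t_gt0 : (0 < t)%N by apply: leq_ltn_trans (ltn_ord i).
set m := (C + (t - i))%N; apply/eqP.
rewrite -(eqn_modDr (m %% t)) -addnA subnK ?(ltnW (ltn_pmod _ _)) // modnDmr.
by rewrite /m addnCA subnKC // ltnW.
Qed.

Lemma reflect_res_eq t C (i : 'I_t) :
  (reflect_res C i == i) = (2 * i == C %[mod t])%N.
Proof.
have /ltnW le_it := ltn_ord i.
rewrite -val_eqE /= -[X in _ == X](modn_small (ltn_ord i)).
rewrite -(eqn_modDr i) -addnA subnK // modnDr addnn -mul2n eq_sym.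
by [].
Qed.

(** Fixed residues solve 2i = C modulo t. Two distinct solutions below t differ by exactly t/2,
    which leaves no room for a third. *)
Lemma card_reflect_res_fixed t C (A : {set 'I_t}) :
  (#|[set i in A | reflect_res C i == i]| <= 2)%N.
Proof.
rewrite leqNgt; apply/negP=> /card_gt2P[i [j [k [[]]]]].
rewrite !inE !reflect_res_eq => /andP[_ /eqP iC] /andP[_ /eqP jC] /andP[_ /eqP kC].
case; rewrite -!val_eqE /= => neij nejk neki.
(* The difference 2b - 2a is a multiple of t strictly between 0 and 2t. *)
have half (a b : 'I_t) : (2 * a = C %[mod t])%N -> (2 * b = C %[mod t])%N ->
    (a < b)%N -> (2 * b = 2 * a + t)%N.
  move=> aC bC ltab; have ltbt := ltn_ord b.
  have : (t %| 2 * b - 2 * a)%N.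
    by rewrite -eqn_mod_dvd ?leq_mul2l ?(ltnW ltab) ?orbT // aC bC.
  move: ltab ltbt; clear=> ltab ltbt; case/dvdnP=> [[|[|q]]]; rewrite ?mulSn; lia.
have neq (a b : 'I_t) : (2 * a = C %[mod t])%N -> (2 * b = C %[mod t])%N ->
    a != b :> nat -> (2 * b = 2 * a + t)%N \/ (2 * a = 2 * b + t)%N.
  by move=> aC bC; case: ltngtP => // ltab _; [left | right]; apply: half.
have := leq_ltn_trans (leq0n i) (ltn_ord i).
case: (neq _ _ iC jC neij) (neq _ _ jC kC nejk) (neq _ _ kC iC neki)
  => [] ij [] jk [] ki; move: ij jk ki; clear; lia.
Qed.

Definition ord_res t (t_gt0 : (0 < t)%N) (x : nat) : 'I_t :=
  Ordinal (ltn_pmod x t_gt0).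

Lemma mem_excess_cols t (t_gt0 : (0 < t)%N) N (lam : N.-tuple nat) j :
  (j \in excess_cols t lam)
    = (ord_res t_gt0 (beta lam j) \in excess_classes t lam).
Proof.
rewrite inE; apply/existsP/idP=> [[i /andP[iE /eqP ji]]|jE].
  by rewrite (_ : ord_res _ _ = i) //; apply: val_inj.
by exists (ord_res t_gt0 (beta lam j)); rewrite jE eqxx.
Qed.

(** Every class outside E contains exactly one column, so the complements of S and of E are
    equinumerous. *)
Lemma card_excess_cols t N (lam : N.-tuple nat) :
  (0 < t)%N -> (forall i : 'I_t, (1 <= nres lam i)%N) ->
  (#|excess_cols t lam| + t = N + #|excess_classes t lam|)%N.
Proof.
move=> t_gt0 hn.
suff : #|~: excess_cols t lam| = #|~: excess_classes t lam|.
  have := cardsC (excess_cols t lam); have := cardsC (excess_classes t lam).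
  by rewrite !card_ord; lia.
rewrite -sum1_card (partition_big (fun j => ord_res t_gt0 (beta lam j))
  (mem (~: excess_classes t lam))) /= => [|j]; last first.
  by rewrite !in_setC (mem_excess_cols t_gt0).
rewrite -sum1_card; apply: eq_bigr => i; rewrite inE => iE.
transitivity (nres lam i); last by move: iE (hn i); rewrite inE; lia.
rewrite /nres -sum1_card; apply: eq_bigl => j.
rewrite !in_setC (mem_excess_cols t_gt0) inE -val_eqE /=.
have [ji|] := eqVneq; last by rewrite andbF.
by rewrite (_ : ord_res _ _ = i) ?iE //; apply: val_inj.
Qed.

(** The reflection x -> C - x of the values is transported to the indices by injectivity of [beta].
    All values of S are at most C, so the subtraction is never truncated. *)
Lemma column_reflection t N (lam : N.-tuple nat) :
  is_partition lam ->
  [seq (excess_sum t lam - x)%N | x <- excess t lam] =i excess t lam ->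
  exists sigma : 'S_N,
    [/\ involutive sigma,
        forall j, j \notin excess_cols t lam -> sigma j = j
      & forall j, j \in excess_cols t lam ->
          [/\ sigma j \in excess_cols t lam,
              (beta lam j <= excess_sum t lam)%N
            & beta lam (sigma j) = (excess_sum t lam - beta lam j)%N]].
Proof.
move=> hlam hsym; set S := excess_cols t lam; set C := excess_sum t lam.
have leC j : j \in S -> (beta lam j <= C)%N.
  by move=> jS; apply/leq_excess_sum/mem_excess; exists j.
have ex j : j \in S -> exists2 j', j' \in S & beta lam j' = (C - beta lam j)%N.
  move=> jS; have : (C - beta lam j)%N \in excess t lam.
    by rewrite -hsym; apply: map_f; apply/mem_excess; exists j.
  by case/mem_excess=> j' j'S ->; exists j'.
(* The default [j] of [odflt] is never returned on [S], because [ex] supplies a match. *)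
pose s j := if j \in S then
  odflt j [pick j' in S | beta lam j' == (C - beta lam j)%N] else j.
have sS j : j \in S -> s j \in S /\ beta lam (s j) = (C - beta lam j)%N.
  move=> jS; rewrite /s jS; case: pickP => [j' /andP[? /eqP]//|] /=.
  by have [j' j'S /eqP bj'] := ex j jS; move/(_ j'); rewrite j'S bj'.
have sK : involutive s.
  move=> j; have [jS|jS] := boolP (j \in S); last by rewrite /s !(negPf jS).
  have [sjS bsj] := sS j jS; have [_ bssj] := sS _ sjS.
  by apply: (beta_inj hlam); rewrite bssj bsj subKn // leC.
exists (perm (inv_inj sK)); split=> [j|j jS|j jS].
- by rewrite !permE sK.
- by rewrite permE /s (negPf jS).
- by rewrite permE; have [? ?] := sS j jS; split=> //; apply: leC.
Qed.

(** * Reflection of the rows, and its sign against that of the columns *)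

Lemma pair_swap_subproof r (k : 'I_(2 * r)) :
  ((if odd k then k.-1 else k.+1) < 2 * r)%N.
Proof. by have := ltn_ord k; case: ifP; lia. Qed.

(** Indices 2i and 2i + 1 will carry z_i and its inverse, so this exchanges the two rows of each
    pair. *)
Definition pair_swap r (k : 'I_(2 * r)) : 'I_(2 * r) :=
  Ordinal (pair_swap_subproof k).

Lemma odd_pair_swap r (k : 'I_(2 * r)) : odd (pair_swap k) = ~~ odd k.
Proof. by rewrite /=; case: ifP; lia. Qed.

Lemma pair_swapK r : involutive (@pair_swap r).
Proof.
move=> k; apply: val_inj => /=; case ok: (odd k) => /=.
  by rewrite ifF; lia.
by rewrite ok.
Qed.

Lemma prod_pair_swap (R : comNzRingType) r (w : 'I_(2 * r) -> R) :
  (forall k, w k * w (pair_swap k) = 1) -> \prod_k w k = 1.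
Proof.
move=> w1; rewrite (bigID (fun k : 'I__ => odd k)) /=.
rewrite [X in _ * X](reindex_inj (inv_inj (@pair_swapK r))).
under [X in _ * X]eq_bigl do rewrite odd_pair_swap negbK.
rewrite -big_split big1 //= => k _; exact: w1.
Qed.

(** The first [t] rows stand for indicator rows of residue classes, the others for the z_i and their
    inverses. Classes outside [E] stay fixed, as do the columns outside S under the column
    reflection. *)
Definition row_reflection t r (E : {set 'I_t}) (C : nat) (a : 'I_(t + 2 * r)) :
    'I_(t + 2 * r) :=
  match split a with
  | inl i => lshift (2 * r) (if i \in E then reflect_res C i else i)
  | inr k => rshift t (pair_swap k)
  end.

Lemma row_reflection_lshift t r E C (i : 'I_t) :
  row_reflection E C (lshift (2 * r) i)
    = lshift (2 * r) (if i \in E then reflect_res C i else i).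
Proof. by rewrite /row_reflection (unsplitK (inl _ i)). Qed.

Lemma row_reflection_rshift t r E C (k : 'I_(2 * r)) :
  row_reflection E C (rshift t k) = rshift t (pair_swap k).
Proof. by rewrite /row_reflection (unsplitK (inr _ k)). Qed.

Lemma row_reflectionK t r (E : {set 'I_t}) C :
  (forall i, i \in E -> reflect_res C i \in E) ->
  involutive (@row_reflection t r E C).
Proof.
move=> EC a; case: (split_ordP a) => [i ->|k ->].
  rewrite !row_reflection_lshift; have [iE|/negPf->//] := boolP (i \in E).
  by rewrite EC // reflect_resK.
by rewrite !row_reflection_rshift pair_swapK.
Qed.

(** All [2 * r] lower rows move, and an upper row moves exactly when its class lies in [E] and is
    not its own reflection. *)
Lemma card_row_reflection_moved t r (E : {set 'I_t}) C :
  (#|[set a | @row_reflection t r E C a != a]|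
     + #|[set i in E | reflect_res C i == i]| = #|E| + 2 * r)%N.
Proof.
rewrite -[#|E|](cardsID [set i | reflect_res C i == i]).
have -> : E :&: [set i | reflect_res C i == i]
    = [set i in E | reflect_res C i == i] by apply/setP=> i; rewrite !inE.
rewrite -addnA addnC; congr (_ + _)%N.
rewrite -sum1_card big_split_ord /=; congr (_ + _)%N.
  rewrite -sum1_card; apply: eq_bigl => i.
  rewrite !inE row_reflection_lshift (inj_eq (@lshift_inj _ _)).
  by case: ifP; rewrite ?eqxx ?andbT ?andbF.
rewrite -[RHS]card_ord -sum1_card; apply: eq_bigl => k.
rewrite !inE row_reflection_rshift (inj_eq (@rshift_inj _ _)) -val_eqE /=.
by case: ifP; lia.
Qed.

(** Two consecutive members of class [i] add up to C. Reflection therefore exchanges them and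
    preserves the class, and C/2 lies strictly between them, where the class has no member. *)
Lemma excess_class_fixed t N (lam : N.-tuple nat) (i : 'I_t) k :
  is_partition lam -> i \in excess_classes t lam ->
  (1 <= k <= nres lam i - 1)%N -> Delta lam i k = excess_sum t lam ->
  reflect_res (excess_sum t lam) i = i
  /\ forall j, j \in excess_cols t lam -> (beta lam j %% t = i)%N ->
       (beta lam j).*2 != excess_sum t lam.
Proof.
move=> hlam iE /andP[k_gt0 lek] Dk; set C := excess_sum t lam.
set L := excess_class lam i.
have sizeL : size L = nres lam i by apply: size_excess_class.
have LP x : x \in L = (x %% t == i)%N && (x \in excess t lam).
  by rewrite mem_sort mem_filter.
have ltkL : (k < size L)%N by lia.
have ltk1L : (k.-1 < size L)%N by lia.
have uniqL : uniq L by rewrite sort_uniq filter_uniq // uniq_excess.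
have sortedL : sorted geq L.
  by apply: sort_sorted => x y; apply: leq_total.
have geq_trans : transitive geq by move=> a b c ? /leq_trans; apply.
have anti p q : (p <= q)%N -> (q < size L)%N -> (nth 0%N L q <= nth 0%N L p)%N.
  move=> lepq ltq; apply: (sorted_leq_nth geq_trans leqnn 0%N sortedL) => //.
  by rewrite inE (leq_ltn_trans lepq).
have neq : nth 0%N L k.-1 != nth 0%N L k by rewrite nth_uniq //; lia.
have Ck : (nth 0%N L k.-1 + nth 0%N L k = C)%N by [].
split=> [|j jS ji].
  have := mem_nth 0%N ltkL; have := mem_nth 0%N ltk1L.
  rewrite !LP => /andP[/eqP ri _] /andP[/eqP si _].
  apply: val_inj; rewrite -[RHS]ri.
  have <- : (C - nth 0 L k = nth 0 L k.-1)%N by rewrite -Ck addnK.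
  by rewrite (reflect_resE _ si) // -Ck leq_addl.
have jL : beta lam j \in L by rewrite LP ji eqxx; apply/mem_excess; exists j.
have [p ltp bp] : exists2 p, (p < size L)%N & nth 0%N L p = beta lam j.
  by exists (index (beta lam j) L); rewrite ?index_mem ?nth_index.
apply/eqP; rewrite -bp => bC.
have := anti k.-1 k (leq_pred k) ltkL.
have [lepk|ltkp] := leqP p k.-1; first by have := anti _ _ lepk ltk1L; lia.
(* A member equal to C/2 would sit at a position up to [k.-1] or from [k] on; monotonicity and [neq]
   refute both. *)
have lekp : (k <= p)%N by lia.
by have := anti _ _ lekp ltp; lia.
Qed.

Lemma reflect_res_excess t N (lam : N.-tuple nat) (sigma : 'S_N) (i : 'I_t) :
  (forall j, j \in excess_cols t lam ->
     [/\ sigma j \in excess_cols t lam, (beta lam j <= excess_sum t lam)%N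
       & beta lam (sigma j) = (excess_sum t lam - beta lam j)%N]) ->
  i \in excess_classes t lam ->
  reflect_res (excess_sum t lam) i \in excess_classes t lam.
Proof.
move=> sigmaS iE; have t_gt0 := leq_ltn_trans (leq0n i) (ltn_ord i).
have : (0 < nres lam i)%N by move: iE; rewrite inE; lia.
case/card_gt0P=> j; rewrite inE => /eqP ji.
have ij : ord_res t_gt0 (beta lam j) = i by apply: val_inj.
have [|sjS leC bsj] := sigmaS j; first by rewrite (mem_excess_cols t_gt0) ij.
rewrite (_ : reflect_res _ _ = ord_res t_gt0 (beta lam (sigma j))).
  by rewrite -mem_excess_cols.
by apply: val_inj; rewrite [RHS]/= bsj (reflect_resE _ ji).
Qed.

(* Both involutions exchange their moved points in pairs.  The column
   reflection fixes no excess column and the row reflection fixes exactly two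
   rows, so the former has exactly one transposition more. *)
Lemma odd_reflections t r (lam : (t + 2 * r).-tuple nat)
    (sigma rho : 'S_(t + 2 * r)) :
  is_partition lam -> (forall i : 'I_t, (1 <= nres lam i)%N) ->
  involutive sigma ->
  (forall j, j \notin excess_cols t lam -> sigma j = j) ->
  (forall j, j \in excess_cols t lam ->
     [/\ sigma j \in excess_cols t lam, (beta lam j <= excess_sum t lam)%N
       & beta lam (sigma j) = (excess_sum t lam - beta lam j)%N]) ->
  involutive rho ->
  rho =1 row_reflection (excess_classes t lam) (excess_sum t lam) ->
  (exists (i : 'I_t) (k : nat),
     [/\ i \in excess_classes t lam, (1 <= k <= nres lam i - 1)%N
       & Delta lam i k = excess_sum t lam]) ->
  odd_perm sigma != odd_perm rho.
Proof.
set S := excess_cols t lam; set E := excess_classes t lam.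
set C := excess_sum t lam.
move=> hlam hn sigmaK sigma_out sigmaS rhoK rhoE [i [k [iE lek Dk]]].
have t_gt0 := leq_ltn_trans (leq0n i) (ltn_ord i).
have [iC no_mid] := excess_class_fixed hlam iE lek Dk.
have [odd_s even_s] := odd_perm_involutive sigmaK.
have [odd_r even_r] := odd_perm_involutive rhoK.
pose FE := [set i' in E | reflect_res C i' == i'].
pose FS := [set j in S | sigma j == j].
have card_r : (#|[set a | rho a != a]| + #|FE| = #|E| + 2 * r)%N.
  rewrite -(card_row_reflection_moved r E C) (_ : [set a | rho a != a] =
    [set a | row_reflection (r := r) E C a != a]) //.
  by apply/setP=> a; rewrite !inE rhoE.
have card_s : (#|[set j | sigma j != j]| + #|FS| = #|S|)%N.
  rewrite addnC -(cardsID [set j | sigma j == j] S); congr addn.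
    by apply: eq_card => j; rewrite !inE.
  apply: eq_card => j; rewrite in_setD 2!in_set.
  have [_|/sigma_out->] := boolP (j \in S); first by rewrite andbT.
  by rewrite eqxx.
have card_S : (#|S| + t = t + 2 * r + #|E|)%N := card_excess_cols t_gt0 hn.
have midFS j : j \in FS -> (beta lam j).*2 = C.
  by rewrite inE => /andP[jS /eqP sj]; have [_ ? ] := sigmaS j jS; rewrite sj; lia.
(* A fixed excess column has value C/2, and [beta] is injective. *)
have FS1 : (#|FS| <= 1)%N.
  apply/card_le1_eqP=> j j' /midFS bj /midFS bj'; apply: (beta_inj hlam); lia.
have FE2 : (#|FE| <= 2)%N by apply: card_reflect_res_fixed.
have iFE : i \in FE by rewrite inE iE iC eqxx.
have FE0 : (0 < #|FE|)%N by apply/card_gt0P; exists i.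
(* The class of C/2 is its own reflection and, by [no_mid], differs from [i]; it is a second fixed
   class. *)
have FS_FE : (0 < #|FS|)%N -> (1 < #|FE|)%N.
  case/card_gt0P=> j jFS; have bj := midFS j jFS.
  have jS : j \in S by move: jFS; rewrite inE => /andP[].
  apply/card_gt1P; exists i, (ord_res t_gt0 (beta lam j)); split=> //.
    rewrite inE -mem_excess_cols jS; apply/eqP/val_inj => /=.
    have := @reflect_resE t C (ord_res t_gt0 (beta lam j)) (beta lam j).
    by rewrite -bj -addnn addnK leq_addl /= => <-.
  apply/eqP=> ij; have := no_mid j jS; rewrite bj eqxx ij => /(_ erefl) //.
(* The moved columns number 2r + |E| - |FS| and the moved rows 2r + |E| - |FE|. Both counts are
   even, so |FS| and |FE| have equal parity; as [FS_FE] rules out |FS| = |FE| = 1, only |FS| = 0 and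
   |FE| = 2 remain. *)
have moved : #|[set j | sigma j != j]| = #|[set a | rho a != a]|.+2.
  move: even_s even_r card_r card_s card_S FS1 FE2 FE0 FS_FE; clear; lia.
by rewrite odd_s odd_r moved /=; case: odd.
Qed.

(** * The specialization point *)

Lemma alternant_matrix_det_eq0 (F : numFieldType) t r
    (lam : (t + 2 * r).-tuple nat) (x : 'I_(t + 2 * r) -> F) :
  is_partition lam -> (forall i : 'I_t, (1 <= nres lam i)%N) ->
  [seq (excess_sum t lam - x)%N | x <- excess t lam] =i excess t lam ->
  (exists (i : 'I_t) (k : nat),
     [/\ i \in excess_classes t lam, (1 <= k <= nres lam i - 1)%N
       & Delta lam i k = excess_sum t lam]) ->
  (forall k, x (lshift (2 * r) k) ^+ t = 1) ->
  (forall k, x (rshift t k) * x (rshift t (pair_swap k)) = 1) ->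
  \det (\matrix_(a, j) x a ^+ beta lam j) = 0.
Proof.
move=> hlam hn hsym hDelta x_root x_pair.
have [i0 _] := hDelta; have t_gt0 := leq_ltn_trans (leq0n i0) (ltn_ord i0).
set S := excess_cols t lam; set E := excess_classes t lam.
set C := excess_sum t lam.
have [sigma [sigmaK sigma_out sigmaS]] := column_reflection hlam hsym.
pose cls j := ord_res t_gt0 (beta lam j).
have SE j : (j \in S) = (cls j \in E) := mem_excess_cols t_gt0 lam j.
have EC i : i \in E -> reflect_res C i \in E := reflect_res_excess sigmaS.
pose rho := perm (inv_inj (@row_reflectionK t r E C EC)).
have rhoE : rho =1 row_reflection E C by move=> a; rewrite permE.
have rhoK : involutive rho.
  by move=> a; rewrite !rhoE; apply: row_reflectionK.
have sgn := odd_reflections hlam hn sigmaK sigma_out sigmaS rhoK rhoE hDelta.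
pose w k := x (rshift t k).
pose A : 'M[F]_(t + 2 * r) := col_mx
  (\matrix_(i < t, j < t + 2 * r) (cls j == i)%:R)
  (\matrix_(k < 2 * r, j < t + 2 * r) if j \in S then w k ^+ beta lam j else 0).
(* A column outside [S] is the only one of its class, so its entries in the
   lower rows are multiples of an indicator row. *)
pose rep i := odflt 0%N (omap (beta lam) [pick j | cls j == i]).
(* The upper block expresses that a power of a [t]-th root of unity depends only on the exponent
   modulo [t]; the lower left block restores the columns outside [S] that [A] sets to 0. *)
pose B : 'M[F]_(t + 2 * r) := block_mx
  (\matrix_(k < t, i < t) x (lshift (2 * r) k) ^+ i) 0
  (\matrix_(k < 2 * r, i < t) if i \in E then 0 else w k ^+ rep i) 1%:M.
have repE j : j \notin S -> rep (cls j) = beta lam j.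
  rewrite SE /rep inE -ltnNge ltnS => /card_le1_eqP le1.
  case: pickP => [j' /eqP/(congr1 val)/= j'j|/(_ j)]; last by rewrite eqxx.
  by rewrite /= (le1 j' j) // inE ?j'j.
have sum_cls (f : 'I_t -> F) j : \sum_i f i * (cls j == i)%:R = f (cls j).
  rewrite (bigD1 (cls j)) //= eqxx mulr1 big1 ?addr0 // => i.
  by rewrite eq_sym => /negPf->; rewrite mulr0.
have -> : \matrix_(a, j) x a ^+ beta lam j = B *m A.
  rewrite mul_block_col mul0mx addr0 mul1mx; apply/matrixP=> a j; rewrite mxE.
  case: (split_ordP a) => [i ->|k ->]; rewrite ?col_mxEu ?col_mxEd.
    rewrite !mxE; under eq_bigr do rewrite !mxE.
    by rewrite sum_cls /= expr_mod.
  rewrite !mxE; under eq_bigr do rewrite !mxE.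
  rewrite sum_cls -SE; have [jS|jS] := boolP (j \in S); first by rewrite add0r.
  by rewrite repE // addr0.
rewrite det_mulmx; suff -> : \det A = 0 by rewrite mulr0.
(* Since w^(C - b) = w^C (w^-1)^b, reflecting the exponents inverts w and costs the factor w^C;
   these factors cancel in inverse pairs. *)
pose d (a : 'I_(t + 2 * r)) := match split a with inl _ => 1 | inr k => w k ^+ C end.
apply: (det_eq0_of_symmetry (d := d) _ _ sgn) => [a j|]; last first.
  rewrite big_split_ord /= big1 => [|i _]; last by rewrite /d (unsplitK (inl _ i)).
  under eq_bigr do rewrite /d (unsplitK (inr _ _)).
  by rewrite mul1r prodrXl prod_pair_swap ?expr1n.
have cls_sigma j' : j' \in S -> cls (sigma j') = reflect_res C (cls j').
  move=> /sigmaS[_ leC bsj]; apply: val_inj; rewrite /= bsj.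
  exact: (@reflect_resE t C (cls j')).
rewrite rhoE; case: (split_ordP a) => [i ->|k ->].
  rewrite row_reflection_lshift !col_mxEu !mxE /d (unsplitK (inl _ i)) mul1r.
  congr (_%:R); congr nat_of_bool.
  (* Outside [S] the column is fixed and its class is not in [E], so the indicators of a class of
     [E] and of its reflection are both 0 there. *)
  have [jS|jS] := boolP (j \in S); last first.
    rewrite sigma_out //; case: ifP => // iE; rewrite SE in jS.
    by apply/eqP/eqP => [ji|ji]; rewrite ji ?EC ?iE in jS.
  rewrite cls_sigma //; case: ifPn => [iE|iE].
    by rewrite (can2_eq (@reflect_resK t C) (@reflect_resK t C)).
  rewrite SE in jS.
  by apply/eqP/eqP => ji; [rewrite -ji EC in iE | rewrite -ji jS in iE].
rewrite row_reflection_rshift !col_mxEd !mxE /d (unsplitK (inr _ k)).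
have [jS|jS] := boolP (j \in S); last by rewrite sigma_out // (negPf jS) mulr0.
have [-> leC ->] := sigmaS j jS; rewrite -[X in w k ^+ X * _](subnK leC).
rewrite exprD -mulrA -exprMn (x_pair k).
by rewrite expr1n mulr1.
Qed.

(** * Powers of the root of unity *)

Lemma zetaX (R : realType) t k :
  zeta R t ^+ k = (cos (2 * pi / t%:R *+ k) +i* sin (2 * pi / t%:R *+ k))%C.
Proof.
rewrite /zeta; set a := 2 * pi / t%:R.
elim: k => [|k IHk]; first by rewrite expr0 mulr0n cos0 sin0.
rewrite exprS IHk mulrS cosD sinD; simpc; congr (_ +i* _)%C.
by rewrite addrC.
Qed.

Lemma zeta_root (R : realType) t : (0 < t)%N -> zeta R t ^+ t = 1.
Proof.
move=> t_gt0; rewrite zetaX -mulr_natr divfK ?pnatr_eq0 -?lt0n //.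
by rewrite mulrC mulr_natr cos2pi sin2pi.
Qed.

(** With y = pi k / t, cos 2y = 1 would force sin y = 0, whereas 0 < y < pi. *)
Lemma zeta_neq1 (R : realType) t k : (0 < k < t)%N -> zeta R t ^+ k != 1.
Proof.
move=> /andP[k_gt0 ltkt]; rewrite zetaX; apply/eqP => -[cos1 _].
pose y : R := pi * k%:R / t%:R.
have t_gt0 : (0 < t)%N by lia.
have ypi : 0 < y < pi.
  apply/andP; split; rewrite /y; first by rewrite !(divr_gt0, mulr_gt0) ?pi_gt0 ?ltr0n.
  by rewrite ltr_pdivrMr ?ltr0n // ltr_pM2l ?pi_gt0 // ltr_nat.
have := sin_gt0_pi ypi; suff -> : sin y = 0 by rewrite ltxx.
have yE : 2 * pi / t%:R *+ k = y *+ 2.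
  by rewrite -[LHS]mulr_natr -[RHS]mulr_natr /y mulrAC [RHS]mulrAC -[_ * _ * k%:R]mulrA
    [2 * _]mulrC.
move: cos1; rewrite yE cos_mulr2n cos2sin2 => cos1.
by apply/eqP; rewrite -sqrf_eq0; apply/eqP; lra.
Qed.

Lemma zeta_inj (R : realType) t (i j : 'I_t) :
  zeta R t ^+ i = zeta R t ^+ j -> i = j.
Proof.
wlog ltij : i j / (i < j)%N => [hwlog ij|ij].
  by case: (ltngtP i j) => [/hwlog|/hwlog|/val_inj//]; [apply | move/(_ (esym ij))].
have t_gt0 := leq_ltn_trans (leq0n i) (ltn_ord i).
have : zeta R t ^+ i != 0.
  have : zeta R t ^+ i * zeta R t ^+ (t - i) != 0.
    by rewrite -exprD subnKC ?zeta_root ?oner_neq0 // ltnW.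
  by rewrite mulf_eq0 negb_or => /andP[].
move=> zi_neq0; have : zeta R t ^+ (j - i) = 1.
  by apply: (mulfI zi_neq0); rewrite -exprD subnKC ?mulr1 // ltnW.
by move/eqP; rewrite (negPf (zeta_neq1 _ _)) //; have := ltn_ord j; lia.
Qed.

(** A monomial of degree d becomes polynomial once multiplied by q^d. The induction adds up the
    degrees of all terms instead of taking their maximum. *)
Lemma meval_clear_denominators (F : fieldType) n (f : {mpoly F[n]})
    (p : 'I_n -> {poly F}) (q : {poly F}) :
  exists (m : nat) (g : {poly F}), forall u, q.[u] != 0 ->
    g.[u] = q.[u] ^+ m * f.@[fun j => (p j).[u] / q.[u]].
Proof.
elim/mpolyind: f => [|c e f _ _ [m [g gE]]].
  by exists 0, 0 => u _; rewrite horner0 meval0 mulr0.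
exists (mdeg e + m)%N.
exists (q ^+ m * (c *: \prod_i p i ^+ e i) + q ^+ mdeg e * g) => u qu0.
have prodE : \prod_i (p i).[u] ^+ e i
    = q.[u] ^+ mdeg e * \prod_i ((p i).[u] / q.[u]) ^+ e i.
  rewrite mdegE -prodrXr -big_split /=; apply: eq_bigr => i _.
  by rewrite expr_div_n mulrC divfK // expf_neq0.
rewrite mevalD mevalZ mevalX hornerD !hornerM hornerZ !horner_exp gE //.
rewrite horner_prod; under eq_bigr do rewrite horner_exp.
rewrite prodE mulrDr exprD !mulrA; congr (_ * _ + _).
by rewrite mulrC mulrA.
Qed.

Lemma meval_alternant (R : comNzRingType) n (a : 'I_n -> nat) (x : 'I_n -> R) :
  (alternant R a).@[x] = \det (\matrix_(i, j) x i ^+ a j).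
Proof.
rewrite /alternant -det_map_mx; congr (\det _).
by apply/matrixP=> i j; rewrite !mxE rmorphXn /= mevalXU.
Qed.

(** * Coordinates of the specialization point, and curves through it *)

Lemma nth_flatten_pairs (T I : Type) (x0 : T) (f g : I -> T) (s : seq I) k :
  nth x0 (flatten [seq [:: f i; g i] | i <- s]) k
    = nth x0 [seq (if odd k then g i else f i) | i <- s] k./2.
Proof.
elim: s k => [|i s IHs] [|[|k]] //=.
by rewrite negbK IHs.
Qed.

Lemma half_ord_subproof r (k : 'I_(2 * r)) : (k./2 < r)%N.
Proof. by have := ltn_ord k; lia. Qed.

Definition half_ord r (k : 'I_(2 * r)) : 'I_r := Ordinal (half_ord_subproof k).

Lemma half_pair_swap r (k : 'I_(2 * r)) : half_ord (pair_swap k) = half_ord k.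
Proof. by apply: val_inj => /=; case: ifP; lia. Qed.

Lemma spec_point_lshift (R : realType) t r (z : 'I_r -> R[i]) (k : 'I_t) :
  spec_point t z (lshift (2 * r) k) = zeta R t ^+ k.
Proof.
rewrite /spec_point /spec_seq nth_cat size_map size_iota /= ltn_ord.
by rewrite (nth_map 0%N) ?size_iota // nth_iota.
Qed.

Lemma spec_point_rshift (R : realType) t r (z : 'I_r -> R[i]) (k : 'I_(2 * r)) :
  spec_point t z (rshift t k)
    = if odd k then (z (half_ord k))^-1 else z (half_ord k).
Proof.
rewrite /spec_point /spec_seq nth_cat size_map size_iota /= ltnNge leq_addr /=
  addKn.
rewrite nth_flatten_pairs (nth_map (half_ord k)) ?size_enum_ord; last first.
  exact: half_ord_subproof.
rewrite (_ : nth _ _ _ = half_ord k) //; apply: val_inj.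
by rewrite /= nth_enum_ord // half_ord_subproof.
Qed.

(** At a point with distinct coordinates the denominator of the quotient defining [schur] is a
    nonzero Vandermonde determinant. *)
Lemma meval_schur_eq0 (F : fieldType) n (lam : n.-tuple nat) (x : 'I_n -> F) :
  injective x -> \det (\matrix_(a, j) x a ^+ beta lam j) = 0 ->
  (schur F lam).@[x] = 0.
Proof.
move=> x_inj det0; have := congr1 (meval x) (schurE F lam).
rewrite mevalM !meval_alternant det0 => /eqP.
by rewrite mulf_eq0 (negPf (det_vandermonde_neq0 x_inj)) orbF => /eqP.
Qed.

(* The values of [f] along the curve [u |-> p(u) / q(u)] are, up to a power of
   [q], those of a polynomial in [u]; all but finitely many points of the curve
   have pairwise distinct coordinates. *)
Lemma meval_eq0_on_curve (F : numFieldType) n (f : {mpoly F[n]})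
    (p : 'I_n -> {poly F}) (q : {poly F}) (u0 : F) (x0 : 'I_n -> F) :
  injective p -> q.[u0] != 0 ->
  (forall a, (p a).[u0] / q.[u0] = x0 a) ->
  (forall u (x : 'I_n -> F), q.[u] != 0 ->
     (forall a, (p a).[u] / q.[u] = x a) -> injective x -> f.@[x] = 0) ->
  f.@[x0] = 0.
Proof.
move=> p_inj q0 x0E f0; have [m [g gE]] := meval_clear_denominators f p q.
have q_neq0 : q != 0 by apply: contraNneq q0 => ->; rewrite horner0.
(* Where [q] is nonzero, [e] vanishes exactly at the parameters for which two coordinates
   coincide. *)
pose e := \prod_a \prod_(b | b != a) (p a - p b).
have e_neq0 : e != 0.
  apply/prodf_neq0 => a _; apply/prodf_neq0 => b nba.
  by rewrite subr_eq0 (inj_eq p_inj) eq_sym.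
(* At every [u] one factor vanishes: [q] or [e] at the exceptional parameters, [g] at all others. *)
have : g * q * e = 0.
  apply: poly_eq0_of_horner => u; rewrite !hornerM.
  have [->|qu0] := eqVneq q.[u] 0; first by rewrite mulr0 mul0r.
  have [->|eu0] := eqVneq e.[u] 0; first by rewrite mulr0.
  rewrite gE // (f0 u _ qu0 (fun=> erefl)) ?mulr0 ?mul0r // => a b.
  move=> /(mulIf (invr_neq0 qu0))/eqP pab; apply/eqP/negPn/negP => nab.
  move: eu0; rewrite horner_prod => /prodf_neq0/(_ b isT).
  rewrite horner_prod => /prodf_neq0/(_ a nab).
  by rewrite !hornerE subr_eq0 eq_sym pab.
move/eqP; rewrite !mulf_eq0 (negPf q_neq0) (negPf e_neq0) !orbF => /eqP g0.
have /esym/eqP := gE u0 q0; rewrite (meval_eq f x0E).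
by rewrite g0 horner0 mulf_eq0 expf_eq0 (negPf q0) andbF => /eqP.
Qed.

Lemma schur_spec_point_eq0 (R : realType) t r (lam : (t + 2 * r).-tuple nat)
    (z : 'I_r -> R[i]) :
  is_partition lam -> (forall i : 'I_t, (1 <= nres lam i)%N) ->
  [seq (excess_sum t lam - x)%N | x <- excess t lam] =i excess t lam ->
  (exists (i : 'I_t) (k : nat),
     [/\ i \in excess_classes t lam, (1 <= k <= nres lam i - 1)%N
       & Delta lam i k = excess_sum t lam]) ->
  (forall i, z i != 0) -> injective (spec_point t z) ->
  (schur R[i] lam).@[spec_point t z] = 0.
Proof.
move=> hlam hn hsym hDelta z_neq0 z_inj.
have det0 : \det (\matrix_(a, j) spec_point t z a ^+ beta lam j) = 0.
  apply: alternant_matrix_det_eq0 hlam hn hsym hDelta _ _ => k.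
    rewrite spec_point_lshift exprAC zeta_root ?expr1n //.
    exact: leq_ltn_trans (ltn_ord k).
  rewrite !spec_point_rshift half_pair_swap odd_pair_swap.
  by case: odd; rewrite ?mulVf ?divff.
exact: meval_schur_eq0 z_inj det0.
Qed.

(** The exponents are positive, so the curve passes through z at 0 and has no constant coordinate;
    they are distinct, so the coordinates are separated by degree whatever z is. *)
Definition curve (F : nzRingType) r (z : 'I_r -> F) (i : 'I_r) : {poly F} :=
  (z i)%:P + 'X^(i.+1).

Lemma horner_curve (F : comNzRingType) r (z : 'I_r -> F) i u :
  (curve z i).[u] = z i + u ^+ i.+1.
Proof. by rewrite hornerD hornerC hornerXn. Qed.

Lemma size_curve (F : nzRingType) r (z : 'I_r -> F) i :
  size (curve z i) = i.+2.
Proof.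
rewrite /curve addrC size_polyDl ?size_polyXn // ltnS.
exact: leq_trans (size_polyC_leq1 _) _.
Qed.

Definition curve_denominator (F : comNzRingType) r (z : 'I_r -> F) : {poly F} :=
  \prod_i curve z i.

(** Numerators over the common denominator; the inverse of one coordinate is the product of the
    other factors over it. *)
Definition curve_numerators (R : realType) t r (z : 'I_r -> R[i])
    (a : 'I_(t + 2 * r)) : {poly R[i]} :=
  match split a with
  | inl k => (zeta R t ^+ k)%:P * curve_denominator z
  | inr k => if odd k then \prod_(i | i != half_ord k) curve z i
             else curve z (half_ord k) * curve_denominator z
  end.
Arguments curve_numerators {R} t {r} z a.

Lemma horner_curve_numerators (R : realType) t r (z : 'I_r -> R[i]) u :
  (curve_denominator z).[u] != 0 ->
  forall a, (curve_numerators t z a).[u] / (curve_denominator z).[u]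
    = spec_point t (fun i => (curve z i).[u]) a.
Proof.
move=> qu0 a; rewrite /curve_numerators; case: (split_ordP a) => [k ->|k ->].
  by rewrite spec_point_lshift hornerM hornerC mulfK.
rewrite spec_point_rshift; case: ifP => _; last by rewrite hornerM mulfK.
move: qu0; rewrite /curve_denominator (bigD1 (half_ord k)) //= hornerM.
by rewrite mulf_eq0 negb_or => /andP[cu0 pu0]; rewrite invfM mulrCA divff ?mulr1.
Qed.

(* The numerators of a root of unity, of [z_i] and of [z_i^-1] have degrees
   [deg q], [deg q + i + 1] and [deg q - i - 1], where [q] is the common
   denominator. *)
Lemma curve_numerators_inj (R : realType) t r (z : 'I_r -> R[i]) :
  injective (curve_numerators t z).
Proof.
set q := curve_denominator z.
have curve_neq0 i : curve z i != 0 by rewrite -size_poly_eq0 size_curve.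
have q_neq0 : q != 0 by apply/prodf_neq0 => i _.
have sizeM i (p : {poly R[i]}) : p != 0 ->
    size (curve z i * p) = (size p + i.+1)%N.
  by move=> p0; rewrite size_mul // size_curve addSn /= addnC.
have size_l (k : 'I_t) : size (curve_numerators t z (lshift (2 * r) k)) = size q.
  rewrite /curve_numerators (unsplitK (inl _ k)) mul_polyC size_scale //.
  rewrite expf_neq0 //; apply/eqP=> zeta0.
  have t_gt0 := leq_ltn_trans (leq0n k) (ltn_ord k).
  have := zeta_root R t_gt0; rewrite zeta0 expr0n eqn0Ngt t_gt0 /= => /eqP.
  by rewrite eq_sym oner_eq0.
(* The shift of degree is added on the side that avoids truncated subtraction. *)
have size_r (k : 'I_(2 * r)) :
    (size (curve_numerators t z (rshift t k)) + (if odd k then k./2.+1 else 0)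
      = size q + (if odd k then 0 else k./2.+1))%N.
  rewrite /curve_numerators (unsplitK (inr _ k)).
  case: ifP => _; last by rewrite addn0 sizeM.
  rewrite addn0 /q /curve_denominator [in RHS](bigD1 (half_ord k)) //= sizeM //.
  by apply/prodf_neq0 => i _.
have sizeE a b : curve_numerators t z a = curve_numerators t z b ->
  size (curve_numerators t z a) = size (curve_numerators t z b) by move->.
move=> a b; case: (split_ordP a) => [k ->|k ->]; case: (split_ordP b) => [l ->|l ->].
- rewrite /curve_numerators (unsplitK (inl _ k)) (unsplitK (inl _ l)).
  by move=> /(mulIf q_neq0)/polyC_inj/zeta_inj->.
- move=> /sizeE; have := size_r l; rewrite size_l => + e; rewrite -e.
  by case: ifP; lia.
- move=> /sizeE; have := size_r k; rewrite size_l => + e; rewrite e.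
  by case: ifP; lia.
- move=> /sizeE e; have := size_r k; have := size_r l; rewrite e => el ek.
  by congr rshift; apply: val_inj; rewrite /=; move: el ek; case: ifP; case: ifP; lia.
Qed.

Theorem theorem8p35 (R : realType) (t r : nat) (lam : (t + 2 * r).-tuple nat)
    (ht : (2 <= t)%N) (hr : (1 <= r)%N)
    (hlam : is_partition lam)
    (hn : forall i : 'I_t, (1 <= nres lam i)%N)
    (hsym : [seq (excess_sum t lam - x)%N | x <- excess t lam] =i excess t lam)
    (hDelta : exists (i : 'I_t) (k : nat),
        [/\ i \in excess_classes t lam, (1 <= k <= nres lam i - 1)%N
          & Delta lam i k = excess_sum t lam]) :
  forall z : 'I_r -> R[i], (forall i, z i != 0) ->
    (schur R[i] lam).@[spec_point t z] = 0.
Proof.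
move=> z z_neq0.
have curve0 i : (curve z i).[0] = z i by rewrite horner_curve expr0n addr0.
have q0 : (curve_denominator z).[0] != 0.
  by rewrite horner_prod; apply/prodf_neq0 => i _; rewrite curve0.
have spec0 a : (curve_numerators t z a).[0] / (curve_denominator z).[0]
    = spec_point t z a.
  rewrite (horner_curve_numerators q0); case: (split_ordP a) => [k ->|k ->].
    by rewrite !spec_point_lshift.
  by rewrite !spec_point_rshift curve0.
(* Where the denominator is nonzero, the curve consists of specialization points with nonzero
   parameters, so the case of distinct coordinates applies. *)
apply: (meval_eq0_on_curve (@curve_numerators_inj R t r z) q0 spec0).
move=> u x qu0 xE x_inj.
have specE : spec_point t (fun i => (curve z i).[u]) =1 x.
  by move=> a; rewrite -xE horner_curve_numerators.
have curve_neq0 i : (curve z i).[u] != 0.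
  by move: qu0; rewrite horner_prod => /prodf_neq0/(_ i isT).
have spec_inj := eq_inj x_inj (fsym specE).
have := schur_spec_point_eq0 hlam hn hsym hDelta curve_neq0 spec_inj.
by rewrite (meval_eq _ specE).
Qed.
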